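(* Let $B$ be a finite rank Bratteli diagram with incidence matrices $\{F_n=(f^{(n)}_{v,w})\}$, let $\overline W=\{W_n\}_{n\ge1}$ be a sequence of non-empty proper subsets $W_n\subset V_n$ determining a subdiagram $B(\overline W)$, and put $W_n'=V_n\setminus W_n$. Let $\mu$ be a finite invariant measure on $B(\overline W)$. (1) Suppose the extension $\widehat\mu$ of $\mu$ to the support $X=X_{B(\overline W)}$ is finite. Then $$\sum_{n=1}^\infty\ \sum_{v\in W_{n+1}}\ \sum_{w\in W_n'} q^{(n)}_{v,w}\,\mu\big(X_v^{(n+1)}(\overline W)\big)<\infty,$$ where $X_v^{(n+1)}(\overline W)$ is the tower in the subdiagram $B(\overline W)$ corresponding to the vertex $v\in W_{n+1}$. (2) If $$\sum_{n=1}^\infty\ \sum_{v\in W_{n+1}}\ \sum_{w\in W_n'} q^{(n)}_{v,w}<\infty,$$ then any invariant probability measure $\mu$ on the path space $Y$ of $B(\overline W)$ extends to a finite measure $\widehat\mu$ on $X$.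
   Context: A Bratteli diagram $B=(V,E)$ is an infinite graph with vertex set $V=\bigsqcup_{i\ge 0}V_i$ and edge set $E=\bigsqcup_{i\ge 1}E_i$, all $V_i,E_i$ finite, $V_0=\{v_0\}$, with range and source maps $r(E_i)=V_i$, $s(E_i)=V_{i-1}$, $s^{-1}(v)\ne\emptyset$ for all $v$ and $r^{-1}(v)\ne\emptyset$ for $v\ne v_0$. $X_B$ is the space of infinite paths from $v_0$, topologized by cylinder sets. $f^{(n)}_{v,w}$ is the number of edges between $w\in V_n$ and $v\in V_{n+1}$. $h^{(n)}_w$ is the number of finite paths in $B$ from $v_0$ to $w\in V_n$, and $$q^{(n)}_{v,w}=f^{(n)}_{v,w}\,\frac{h_w^{(n)}}{h_v^{(n+1)}},\qquad v\in V_{n+1},\ w\in V_n,\ n\ge1,$$ are the entries of a stochastic matrix $Q_n$. Standing assumptions on finite rank diagrams: the same number $d$ of vertices at each level $n\ge1$; a single edge from $v_0$ to each vertex of $V_1$; $X_B$ has no isolated points; the tail equivalence relation $\mathcal E$ ($x\mathcal E y$ iff $x_n=y_n$ for all large $n$) has no finite classes. The subdiagram $B(\overline W)$ is formed by $v_0$, the vertices of the $W_n$ and all edges of $B$ connecting them, and it is assumed to be itself a Bratteli diagram. $Y$ is its path space, $X=X_{B(\overline W)}=\mathcal E(Y)$ is the set of paths of $B$ cofinal to a path in $Y$, and for $v\in W_n$, $X_v^{(n)}(\overline W)\subset Y$ is the set of paths of $B(\overline W)$ passing through $v$ at level $n$. A measure on a diagram is invariant if it is a Borel non-atomic measure on the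 path space giving equal mass to the cylinder sets of any two finite paths from $v_0$ with the same range. The extension $\widehat\mu$ of a finite invariant measure $\mu$ on $Y$ is the $\mathcal E$-invariant measure on $X$ (finite or infinite) whose restriction to $Y$ is $\mu$; its total mass is $\widehat\mu(X)=\lim_{n\to\infty}\sum_{w\in W_n}h_w^{(n)}\mu([e(v_0,w)])$, where $e(v_0,w)$ is any finite path in $B(\overline W)$ from $v_0$ to $w$ and $[e(v_0,w)]\subset Y$ its cylinder set. *)

(* Defs.v *)
From HB Require Import structures.
From mathcomp Require Import all_boot all_order all_algebra.
From mathcomp Require Import all_classical all_reals all_analysis.

Set Implicit Arguments.
Unset Strict Implicit.
Unset Printing Implicit Defensive.

Import Order.TTheory GRing.Theory Num.Theory.
Local Open Scope classical_set_scope.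
Local Open Scope ring_scope.

(* [edge n] is the set of edges from level n to level n.+1, which is often
   written E_(n+1). *)
Record bratteli := Bratteli {
  vert : nat -> finType;
  edge : nat -> finType;
  src : forall n, edge n -> vert n;
  rng : forall n, edge n -> vert n.+1;
  root : vert 0;
  root_unique : forall v : vert 0, v = root;
  src_surj : forall n (v : vert n), exists e : edge n, src e = v;
  rng_surj : forall n (v : vert n.+1), exists e : edge n, rng e = v }.

Arguments src {b n}.
Arguments rng {b n}.

Section Diagram.
Variable B : bratteli.
Implicit Types n m : nat.

Record bpath := BPath {
  path_edge :> forall n, edge B n;
  path_compat : forall n, rng (path_edge n) = src (path_edge n.+1) }.

Definition path_vertex (x : bpath) n : vert B n := src (x n).

(* Finite paths from the root to [v], described from their last edge. *)
Fixpoint fpath n : vert B n -> finType :=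
  match n with
  | 0 => fun=> unit
  | m.+1 => fun v => {e : {e : edge B m | rng e == v} & fpath (src (val e))}
  end.

Fixpoint starts_with n : forall v : vert B n, fpath v -> bpath -> Prop :=
  match n with
  | 0 => fun _ _ _ => True
  | m.+1 => fun v p x => x m = val (tag p) /\ starts_with (tagged p) x
  end.

Definition cylinder n (v : vert B n) (p : fpath v) : set bpath :=
  [set x | starts_with p x].

Definition bopen : set (set bpath) :=
  [set U | forall x, U x -> exists n (v : vert B n) (p : fpath v),
                       cylinder p x /\ cylinder p `<=` U].

(* A path to make [bpath] pointed, as the library's measurable types must be *)
Definition next_edge n (v : vert B n) : edge B n := projT1 (cid (src_surj v)).

Lemma src_next_edge n (v : vert B n) : src (next_edge v) = v.
Proof. exact: projT2 (cid (src_surj v)). Qed.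

Fixpoint default_vertex n : vert B n :=
  match n with
  | 0 => root B
  | m.+1 => rng (next_edge (default_vertex m))
  end.

Definition default_path : bpath :=
  @BPath (fun n => next_edge (default_vertex n))
         (fun n => esym (src_next_edge (default_vertex n.+1))).

Lemma starts_withP n (v : vert B n) (p : fpath v) (x y : bpath) :
  starts_with p x ->
  (starts_with p y <-> forall i, (i < n)%N -> y i = x i).
Proof.
elim: n v p => [|n IH] v p //= [xp /IH {}IH]; split.
  move=> [yp /IH yx] i; rewrite ltnS leq_eqVlt => /orP[/eqP ->|/yx //].
  by rewrite yp.
by move=> yx; rewrite yx //; split=> //; apply/IH => i /ltnW/yx.
Qed.

Lemma prefix_exists (x : bpath) n :
  exists p : fpath (path_vertex x n), starts_with p x.
Proof.
elim: n => [|n [p px]]; first by exists tt.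
have xn : rng (x n) == path_vertex x n.+1 by apply/eqP; exact: path_compat.
by exists (Tagged (fun e : {e | rng e == _} => fpath (src (val e)))
                  (p : fpath (src (val (exist (fun e => rng e == _) (x n) xn))))).
Qed.

Lemma bopenT : bopen setT.
Proof. by move=> x _; exists 0, (root B), (tt : fpath (root B)). Qed.

Lemma bopenI : setI_closed bopen.
Proof.
move=> U U' oU oU' x [/oU[n [v [p [px pU]]]] /oU'[m [w [p' [px' pU']]]]].
have [r rx] := prefix_exists x (maxn n m).
exists (maxn n m), (path_vertex x (maxn n m)), r; split=> // y.
move=> /(starts_withP _ rx) yx; split.
  by apply/pU/(starts_withP _ px) => i /leq_trans ltin; apply/yx/ltin/leq_maxl.
by apply/pU'/(starts_withP _ px') => i /leq_trans ltim; apply/yx/ltim/leq_maxr.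
Qed.

Lemma bopen_bigU (I : Type) (f : I -> set bpath) :
  (forall i, bopen (f i)) -> bopen (\bigcup_i f i).
Proof.
move=> of_ x [i _ /of_[n [v [p [px pf]]]]]; exists n, v, p; split=> //.
by move=> y /pf; exists i.
Qed.

HB.instance Definition _ := gen_eqMixin bpath.
HB.instance Definition _ := gen_choiceMixin bpath.
HB.instance Definition _ := isPointed.Build bpath default_path.
HB.instance Definition _ :=
  isOpenTopological.Build bpath bopenT bopenI bopen_bigU.

Definition tail_equiv (x y : bpath) : Prop :=
  exists N, forall n, (N <= n)%N -> x n = y n.

(* The entries f^(n)_(v,w), h^(n)_w and q^(n)_(v,w) of the usual notation. The
   single edges to level 1 make q^(0) meaningful too, but only n >= 1 is used. *)
Definition incidence n (v : vert B n.+1) (w : vert B n) : nat :=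
  #|[set e : edge B n | (src e == w) && (rng e == v)]|.

Definition height n (v : vert B n) : nat := #|fpath v|.

Definition stochastic (R : realType) n (v : vert B n.+1) (w : vert B n) : R :=
  (incidence v w)%:R * ((height w)%:R / (height v)%:R).

Record finite_rank (d : nat) : Prop := FiniteRank {
  card_level : forall n, (0 < n)%N -> #|vert B n| = d;
  single_root_edges : forall v : vert B 1, incidence v (root B) = 1%N;
  no_isolated_points : isolated [set: bpath] = set0;
  no_finite_classes : forall x, ~ finite_set [set y | tail_equiv x y] }.

Definition borel_path := g_sigma_algebraType (@open bpath).

Definition nonatomic (R : realType)
    (mu : {measure set borel_path -> \bar R}) : Prop :=
  forall A : set borel_path, measurable A -> (0 < mu A)%E ->
  exists C : set borel_path,
    [/\ measurable C, C `<=` A, (0 < mu C)%E & (mu C < mu A)%E].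

Definition invariant_measure (R : realType)
    (mu : {measure set borel_path -> \bar R}) : Prop :=
  nonatomic mu /\
  forall n (v : vert B n) (p p' : fpath v), mu (cylinder p) = mu (cylinder p').

(* Invariance with respect to the tail equivalence relation, i.e. under all
   Borel partial bijections whose graph is contained in it. For finite measures
   this amounts to equal masses of the cylinder sets of finite paths with the
   same range. That condition is not enough for an infinite measure: cylinder
   sets may all have infinite mass. *)
Definition tail_invariant (R : realType)
    (mu : {measure set borel_path -> \bar R}) : Prop :=
  forall (A A' : set borel_path) (f : borel_path -> borel_path),
    measurable A -> measurable A' -> measurable_fun A f -> set_bij A A' f ->
    (forall x, A x -> tail_equiv x (f x)) -> mu A = mu A'.

End Diagram.

(* A sequence of vertex sets such that these vertices and all the edges
   connecting them form a Bratteli diagram. Level 0 consists of the root. *)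
Record subdiagram (B : bratteli) := Subdiagram {
  subvert :> forall n, {set vert B n};
  sub_root : root B \in subvert 0;
  sub_src : forall n (v : vert B n), v \in subvert n ->
    exists2 e : edge B n, src e = v & rng e \in subvert n.+1;
  sub_rng : forall n (v : vert B n.+1), v \in subvert n.+1 ->
    exists2 e : edge B n, rng e = v & src e \in subvert n }.

Section Subdiagram.
Variables (B : bratteli) (W : subdiagram B).

Definition svert n : finType := {v : vert B n | v \in W n}.

Definition sedge n : finType :=
  {e : edge B n | (src e \in W n) && (rng e \in W n.+1)}.

Definition ssrc n (e : sedge n) : svert n :=
  exist _ (src (val e)) (proj1 (andP (valP e))).

Definition srng n (e : sedge n) : svert n.+1 :=
  exist _ (rng (val e)) (proj2 (andP (valP e))).

Definition sroot : svert 0 := exist _ (root B) (sub_root W).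

Lemma sroot_unique (v : svert 0) : v = sroot.
Proof. exact/val_inj/root_unique. Qed.

Lemma ssrc_surj n (v : svert n) : exists e : sedge n, ssrc e = v.
Proof.
have [e ev eW] := sub_src (valP v).
have eP : (src e \in W n) && (rng e \in W n.+1) by rewrite ev (valP v).
by exists (exist _ e eP); exact: val_inj.
Qed.

Lemma srng_surj n (v : svert n.+1) : exists e : sedge n, srng e = v.
Proof.
have [e ev eW] := sub_rng (valP v).
have eP : (src e \in W n) && (rng e \in W n.+1) by rewrite ev (valP v) eW.
by exists (exist _ e eP); exact: val_inj.
Qed.

Definition sub_bratteli : bratteli :=
  Bratteli sroot_unique ssrc_surj srng_surj.

Lemma sub_path_compat (y : bpath sub_bratteli) n :
  rng (val (y n)) = src (val (y n.+1)).
Proof. exact: (congr1 (fun v : svert n.+1 => val v) (path_compat y n)). Qed.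

Definition sub_path_incl (y : bpath sub_bratteli) : bpath B :=
  @BPath B (fun n => val (y n)) (sub_path_compat y).

Definition tower n (v : vert B n) : set (bpath sub_bratteli) :=
  [set y | path_vertex (sub_path_incl y) n = v].

Definition saturation : set (bpath B) :=
  [set x | exists y, tail_equiv x (sub_path_incl y)].

(* A measure on the saturation is encoded as a measure on the path space of B
   for which the complement of the saturation is null. *)
Record is_extension (R : realType)
    (mu : {measure set (borel_path sub_bratteli) -> \bar R})
    (muhat : {measure set (borel_path B) -> \bar R}) : Prop := IsExtension {
  extension_support : muhat (~` saturation) = 0%E;
  extension_nonatomic : nonatomic muhat;
  extension_invariant : tail_invariant muhat;
  extension_restriction : forall A : set (borel_path sub_bratteli),
    measurable A -> muhat [set sub_path_incl y | y in A] = mu A }.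

End Subdiagram.

Arguments tower {B} W {n} v.

(* Main.v *)
(* Let X_n be the set of paths whose vertices lie in W from level n on. These
   sets increase to the saturation X of Y, and X_n is a disjoint union of copies
   of cylinder sets of Y with their prefixes exchanged. An extension muhat is
   tail invariant, so it has the same mass on all X_n /\ [p] with p ending at v,
   and counting the finite paths p whose last edge starts outside W gives
     muhat(X_(n+1) \ X_n) =
       sum_(v in W_(n+1)) sum_(w in W'_n)
         q_(v,w) muhat {x in X_(n+1) | x passes through v at level n+1}.
   For (1), the mass on the right is at least mu of the tower of v, and the left
   sides sum up to at most muhat(X). For (2), the equation yields
   muhat(X_(n+1)) <= muhat(X_n) + e_n muhat(X_(n+1)) with (e_n) summable, so the
   masses of the X_n are bounded. The extension exists without any assumption on
   its mass: it is the sum over all finite paths p of the images of mu under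
   prefix exchange with p, each restricted to the paths that enter W for good
   exactly at the end of p. *)
From HB Require Import structures.
Require Import Defs.
From mathcomp Require Import all_boot all_order all_algebra.
From mathcomp Require Import all_classical all_reals all_analysis.
From mathcomp Require Import lra.
(* Imported again because mathcomp's [path] shadows [fpath]. *)
Import Defs.

Set Implicit Arguments.
Unset Strict Implicit.
Unset Printing Implicit Defensive.

Import Order.TTheory GRing.Theory Num.Theory.
Local Open Scope classical_set_scope.
Local Open Scope ring_scope.
Local Open Scope ereal_scope.

(** * Paths, cylinder sets and the exchange of prefixes *)

Section Paths.
Variable B : bratteli.
Implicit Types (x y z : bpath B) (n m : nat).

Lemma bpath_ext x y : (forall n, x n = y n) -> x = y.
Proof.
case: x y => [x cx] [y cy] /= xy.
have {}xy : x = y by exact: functional_extensionality_dep.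
by subst y; rewrite (Prop_irrelevance cx cy).
Qed.

(** The prefix is read off an infinite path instead of an [fpath], whose type depends on its end
    vertex; [cylinderE] translates between the two. *)
Definition pcyl n x : set (bpath B) :=
  [set z | forall i, (i < n)%N -> z i = x i].

Lemma pcylS n x z : pcyl n.+1 x z <-> pcyl n x z /\ z n = x n.
Proof.
split=> [xz|[xz zn] i]; first by split=> [i /ltnW/xz|]; [|exact: xz].
by rewrite ltnS leq_eqVlt => /predU1P[->|/xz].
Qed.

Lemma pcyl_vertex n x z : pcyl n x z -> path_vertex z n = path_vertex x n.
Proof.
case: n => [_|n xz]; first by rewrite [LHS]root_unique [RHS]root_unique.
by rewrite /path_vertex -!path_compat xz.
Qed.

Lemma pcyl_eq n x z : pcyl n x z -> pcyl n z = pcyl n x.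
Proof.
move=> xz; apply/seteqP; split=> t xt i ltin; first by rewrite xt// xz.
by rewrite xt// xz.
Qed.

Lemma cylinderE n (v : vert B n) (p : fpath v) x :
  starts_with p x -> cylinder p = pcyl n x.
Proof. by move=> px; apply/seteqP; split=> z /(starts_withP z px). Qed.

Lemma cylinder_vertex n (v : vert B n) (p : fpath v) x :
  cylinder p x -> path_vertex x n = v.
Proof.
case: n v p => [|n] v p; first by rewrite [LHS]root_unique [RHS]root_unique.
by case=> xn _; rewrite /path_vertex -path_compat xn (eqP (valP (tag p))).
Qed.

Lemma cylinder_inj n (v : vert B n) (p p' : fpath v) x :
  cylinder p x -> cylinder p' x -> p = p'.
Proof.
elim: n v p p' => [|n IH] v; first by case=> -[].
move=> [e p] [e' p'] [/= xe px] [/= xe' px'].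
have ee' : e = e' by apply: val_inj; exact: etrans (esym xe) xe'.
by subst e'; rewrite (IH _ p p').
Qed.

Lemma vertex_path n (v : vert B n) : exists x, path_vertex x n = v.
Proof.
elim: n v => [v|n IH v].
  by exists (default_path B); rewrite [LHS]root_unique [RHS]root_unique.
have [e ev] := rng_surj v.
have [x xe] := IH (src e).
(* The new path follows [x] up to level [n], takes [e] into [v] and continues along the edges
   [next_edge]. [u] and [g] are its vertices and edges; [dfwith] places [v] and [e] at one index
   without a type cast. *)
pose u := fix u k : vert B k := match k with
  | 0 => root B
  | m.+1 => if (m.+1 == n.+1)%N then eqtype.dfwith (path_vertex x) v m.+1
            else if (m < n)%N then path_vertex x m.+1 else rng (next_edge (u m))
  end.
pose g k : edge B k := if (k < n)%N then x k else eqtype.dfwith (fun k =>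
  next_edge (u k)) e k.
have un : u n.+1 = v by rewrite /= eqxx dfwith_in.
have gc k : rng (g k) = src (g k.+1).
  rewrite /g; have [ltkn|ltnk|->] := ltngtP k n.
  - have [ltSkn|] := ltnP k.+1 n; first exact: path_compat.
    move=> lenk; have ek : k.+1 = n by apply/eqP; rewrite eqn_leq ltkn lenk.
    by subst n; rewrite dfwith_in path_compat -/(path_vertex x k.+1) xe.
  - rewrite ltnNge (leq_trans (ltnW ltnk) (leqnSn _)) /=.
    rewrite dfwith_out; last by rewrite ltn_eqF.
    rewrite dfwith_out; last by rewrite ltn_eqF// (leq_trans ltnk).
    by rewrite src_next_edge /= eqSS gtn_eqF// ltnNge (ltnW ltnk).
  - rewrite ltnNge leqnSn /= dfwith_in dfwith_out; last by rewrite ltn_eqF.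
    by rewrite src_next_edge un.
exists (BPath gc); rewrite /path_vertex -path_compat /= /g ltnn dfwith_in.
exact: ev.
Qed.

Lemma cylinder_nonempty n (v : vert B n) (p : fpath v) : cylinder p !=set0.
Proof.
(* Stronger claim for the induction: [p] can be continued by any compatible edges [g i], [n <= i],
   that start at [v]. The induction step writes the last edge of [p] into [g] at the preceding
   index. *)
suff H g : src (g n) = v -> (forall i, (n <= i)%N -> rng (g i) =
  src (g i.+1)) ->
    exists2 x, starts_with p x & forall i, (n <= i)%N -> x i = g i.
  have [x xv] := vertex_path v.
  by have [|i _|z pz _] := H x; [exact: xv|exact: path_compat|exists z].
elim: n v p g => [v [] g _ gc|n IH v [e p] g gv gc].
  by exists (BPath (fun i => gc i isT)).
have [||x px xg] := IH _ p (eqtype.dfwith g (val e)).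
- by rewrite dfwith_in.
- move=> i; rewrite leq_eqVlt => /predU1P[<-|ltni].
    rewrite dfwith_in dfwith_out; last by rewrite ltn_eqF.
    by rewrite gv (eqP (valP e)).
  rewrite !dfwith_out ?gc// ltn_eqF//; exact: ltnW.
exists x; first by split=> //=; rewrite xg// dfwith_in.
by move=> i ltni; rewrite xg ?(ltnW ltni)// dfwith_out// ltn_eqF.
Qed.

Lemma height_gt0 n (v : vert B n) : (0 < height v)%N.
Proof.
have [x xv] := vertex_path v; have [p _] := prefix_exists x n.
by rewrite xv in p; apply/card_gt0P; exists p.
Qed.

Lemma splice_compat n x y : path_vertex x n = path_vertex y n ->
  forall i, rng (if (i < n)%N then x i else y i) =
            src (if (i.+1 < n)%N then x i.+1 else y i.+1).
Proof.
move=> xy i; case: (ltngtP i.+1 n) => [ltin|ltni|ein].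
- exact: path_compat.
- exact: path_compat.
- by subst n; rewrite path_compat.
Qed.

(* Junk value [y] when [x] and [y] have different vertices at level [n]. *)
Definition splice n x y : bpath B :=
  match pselect (path_vertex x n = path_vertex y n) with
  | left xy => BPath (splice_compat xy)
  | right _ => y
  end.

Lemma splice_lt n x y i : path_vertex x n = path_vertex y n ->
  (i < n)%N -> splice n x y i = x i.
Proof. by rewrite /splice; case: pselect => //= _ _ ->. Qed.

Lemma splice_ge n x y i : (n <= i)%N -> splice n x y i = y i.
Proof. by rewrite /splice; case: pselect => //= _; rewrite leqNgt =>
  /negbTE ->. Qed.

Lemma splice_pcyl n x y :
  path_vertex x n = path_vertex y n -> pcyl n x (splice n x y).
Proof. by move=> xy i; exact: splice_lt. Qed.

Lemma splice_vertex n x y m : (n <= m)%N -> path_vertex (splice n x y) m =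
  path_vertex y m.
Proof. by move=> lenm; rewrite /path_vertex splice_ge. Qed.

Lemma splice_id n x y : pcyl n x y -> splice n x y = y.
Proof.
move=> xy; apply: bpath_ext => i; have /esym xyn := pcyl_vertex xy.
have [ltin|leni] := ltnP i n; last by rewrite splice_ge.
by rewrite splice_lt// (xy i ltin).
Qed.

(** Together with [splice_id], this shows that exchanging two prefixes with a common end vertex is
    undone by exchanging them back. *)
Lemma splice_splice n x y z : path_vertex x n = path_vertex z n ->
  path_vertex y n = path_vertex z n -> splice n x (splice n y z) = splice n x z.
Proof.
move=> xz yz; apply: bpath_ext => i.
have xyz : path_vertex x n = path_vertex (splice n y z) n.
  by rewrite splice_vertex.
have [ltin|leni] := ltnP i n; first by rewrite !splice_lt.
by rewrite !splice_ge.
Qed.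

End Paths.


(** * Measures of finite disjoint unions *)

Lemma measure_fintype_bigcup d (T : measurableType d) (R : realType)
    (mu : {measure set T -> \bar R}) (I : finType) (F : I -> set T) :
  (forall i, measurable (F i)) -> trivIset setT F ->
  mu (\bigcup_i F i) = \sum_i mu (F i).
Proof.
move=> mF tF; rewrite measure_fin_bigcup//; last exact: finite_finset.
rewrite -[RHS]big_enum /= [RHS]fsbig_seq ?enum_uniq//.
apply: (@eq_fsbigl _ _ _ _ (fun i => mu (F i))).
by apply/seteqP; split=> i //= _; rewrite mem_enum.
Qed.

Lemma measure_fintype_setI d (T : measurableType d) (R : realType)
    (mu : {measure set T -> \bar R}) (I : finType) (F : I -> set T) (A :
      set T) :
  measurable A -> (forall i, measurable (F i)) -> trivIset setT F ->
  A `<=` \bigcup_i F i -> mu A = \sum_i mu (A `&` F i).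
Proof.
move=> mA mF tF AF; rewrite -measure_fintype_bigcup; last first.
- exact: trivIset_setIl.
- by move=> i; exact: measurableI.
by rewrite -setI_bigcupr (setIidl AF).
Qed.

(** * Borel sets of the path space *)

Section BorelPaths.
Variable B : bratteli.
Implicit Types (x y z : bpath B) (n m : nat).

(** Indexes the finite partition of the path space into the cylinders of length [n]. *)
Definition fprefix n : finType := {v : vert B n & fpath v}.

Lemma prefix_of_ex n x : exists p : fprefix n, cylinder (tagged p) x.
Proof.
by have [p px] := prefix_exists x n; exists (Tagged (@fpath B n) p).
Qed.

Definition prefix_of n x : fprefix n := projT1 (cid (prefix_of_ex n x)).

Lemma prefix_ofP n x : cylinder (tagged (prefix_of n x)) x.
Proof. exact: projT2 (cid (prefix_of_ex n x)). Qed.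

Lemma prefix_of_vertex n x : tag (prefix_of n x) = path_vertex x n.
Proof. exact/esym/(cylinder_vertex (prefix_ofP n x)). Qed.

Lemma prefix_ofE n x (p : fprefix n) :
  prefix_of n x = p <-> cylinder (tagged p) x.
Proof.
split=> [<-|px]; first exact: prefix_ofP.
have := prefix_ofP n x.
have vp : tag (prefix_of n x) = tag p.
  by rewrite prefix_of_vertex (cylinder_vertex px).
case: (prefix_of n x) p vp px => [v q] [w p] /= vw; subst w => px qx.
by rewrite (cylinder_inj px qx).
Qed.

Lemma prefix_of_eq n x z : prefix_of n z = prefix_of n x <-> pcyl n x z.
Proof. by rewrite prefix_ofE (cylinderE (prefix_ofP n x)). Qed.

Lemma bopenE (U : set (bpath B)) : @open (bpath B) U = bopen U.
Proof. by []. Qed.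

Lemma open_local n (A : set (bpath B)) :
  (forall x z, A x -> pcyl n x z -> A z) -> @open (bpath B) A.
Proof.
move=> locA; rewrite bopenE => x Ax; have [p px] := prefix_exists x n.
exists n, (path_vertex x n), p; split=> // z; rewrite (cylinderE px).
exact: locA.
Qed.

Lemma measurable_local n (A : set (borel_path B)) :
  (forall x z, A x -> pcyl n x z -> A z) -> measurable A.
Proof. by move=> locA; apply: sub_sigma_algebra; exact: (@open_local n). Qed.

Lemma measurable_pcyl n x : measurable (pcyl n x : set (borel_path B)).
Proof. by apply: (@measurable_local n) => y z xy yz; rewrite -(pcyl_eq xy). Qed.

Lemma measurable_cylinder n (v : vert B n) (p : fpath v) :
  measurable (cylinder p : set (borel_path B)).
Proof.
have [x px] := cylinder_nonempty p; rewrite (cylinderE px).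
exact: measurable_pcyl.
Qed.

Lemma measurable_vertex n (P : set (vert B n)) :
  measurable ([set x | P (path_vertex x n)] : set (borel_path B)).
Proof. by apply: (@measurable_local n) => x z /= Px /pcyl_vertex ->. Qed.

Lemma trivIset_cylinder n :
  trivIset setT (fun p : fprefix n => cylinder (tagged p) : set (borel_path B)).
Proof. by move=> p q _ _ [x [/prefix_ofE <- /prefix_ofE <-]]. Qed.

Section Generator.
Variable n : nat.

(* Prefixes shorter than [n] are left out so that [splice n x] pulls cylinders
   back to cylinders. *)
Definition pcyls : set (set (borel_path B)) :=
  [set A | A = set0 \/ A = setT \/
            exists2 m, (n <= m)%N & exists z, A = pcyl m z].

Lemma setI_closed_pcyls : setI_closed pcyls.
Proof.
move=> A A' [->|[->|[m lenm [z ->]]]]; first by rewrite set0I; left.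
  by rewrite setTI.
case=> [->|[->|[m' lenm' [z' ->]]]]; first by rewrite setI0; left.
  by rewrite setIT; right; right; exists m => //; exists z.
have [->|/set0P[t [zt z't]]] := eqVneq (pcyl m z `&` pcyl m' z') set0.
  by left.
rewrite -(pcyl_eq zt) -(pcyl_eq z't).
right; right; exists (maxn m m'); first by rewrite leq_max lenm.
exists t; apply/seteqP; split=> [x [tx t'x] i|x tx].
  by rewrite leq_max => /orP[/tx|/t'x].
by split=> i ltim; apply: tx; rewrite leq_max ltim ?orbT.
Qed.

(** An open set is the union of the cylinders of length at least [n] inside it, since a longer
    prefix only shrinks a cylinder, and there are countably many of them. *)
Lemma measurable_pcyls : @measurable _ (borel_path B) = <<s pcyls >>.
Proof.
apply/seteqP; split; last first.
  apply: smallest_sub; first exact: sigma_algebra_measurable.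
  move=> A [->|[->|[m _ [z ->]]]]; [exact: measurable0|exact: measurableT|].
  exact: measurable_pcyl.
apply: smallest_sub; first exact: smallest_sigma_algebra.
move=> U; rewrite bopenE => oU.
pose F (q : {m : nat & fprefix (n + m)}) : set (g_sigma_algebraType pcyls) :=
  if `[< cylinder (tagged (tagged q)) `<=` U >] then cylinder (tagged (tagged
    q))
  else set0.
suff -> : U = \bigcup_q F q.
  apply: (@countable_bigcupT_measurable _ (g_sigma_algebraType pcyls)).
    exact: countableP.
  move=> [m p]; rewrite /F /=; case: asboolP => _; last exact: measurable0.
  apply: sub_sigma_algebra; right; right; exists (n + m)%N; first exact:
    leq_addr.
  have [x px] := cylinder_nonempty (tagged p).
  by exists x; rewrite (cylinderE px).
apply/seteqP; split=> [x Ux|x [[m p] _]]; last first.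
  by rewrite /F /=; case: asboolP => // pU /pU.
have [m [v [p [px pU]]]] := oU x Ux.
exists (Tagged (fun m => fprefix (n + m)) (prefix_of (n + m) x)) => //.
rewrite /F /=; case: asboolP => [_|]; first exact: prefix_ofP.
apply: contra_notP => _ z; rewrite (cylinderE (prefix_ofP _ _)) => xz.
apply: pU; rewrite (cylinderE px) => i ltim.
by apply: xz; rewrite (leq_trans ltim)// leq_addl.
Qed.

End Generator.

End BorelPaths.

(** The hypothesis is continuity of [f]: preimages of cylinders are open, and cylinders generate the
    Borel sets. *)
Lemma measurable_fun_local (B B' : bratteli) (f : bpath B -> bpath B') :
  (forall x n, exists m, forall z, pcyl m x z -> pcyl n (f x) (f z)) ->
  measurable_fun setT (f : borel_path B -> borel_path B').
Proof.
move=> locf; apply: (@measurability _ _ (borel_path B) (borel_path B') setT f _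
  (measurable_pcyls B' 0)).
move=> _ [_ [->|[->|[n _ [z ->]]]] <-]; rewrite setTI.
- by rewrite preimage_set0; exact: measurable0.
- by rewrite preimage_setT; exact: measurableT.
apply: sub_sigma_algebra; rewrite bopenE => x /= zx.
have [m mf] := locf x n; have [p px] := prefix_exists x m.
exists m, (path_vertex x m), p; split=> // t; rewrite (cylinderE px) => /mf.
by rewrite (pcyl_eq zx).
Qed.

Lemma measurable_splice (B : bratteli) n (x : bpath B) :
  measurable_fun setT (splice n x : borel_path B -> borel_path B).
Proof.
(* The first [n] edges decide whether [splice] takes its junk value. *)
apply: measurable_fun_local => y m; exists (maxn n m) => z yz i ltim.
have yzn : path_vertex z n = path_vertex y n.
  by apply: pcyl_vertex => j ltjn; apply: yz; rewrite leq_max ltjn.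
have yzi : z i = y i by apply: yz; rewrite leq_max ltim orbT.
rewrite /splice; case: pselect => [zx|zx]; case: pselect => //= yx.
- by rewrite yzi.
- by case: yx; rewrite -yzn.
- by case: zx; rewrite yzn.
Qed.

(** * Invariant measures under the exchange of prefixes *)

Section Exchange.
Variables (B : bratteli) (R : realType).
Variable mu : {finite_measure set (borel_path B) -> \bar R}.
Hypothesis mu_inv : invariant_measure mu.

Lemma invariant_pcyl n (x y : bpath B) :
  path_vertex x n = path_vertex y n -> mu (pcyl n x) = mu (pcyl n y).
Proof.
have [p px] := prefix_exists x n; have [q qy] := prefix_exists y n.
rewrite -(cylinderE px) -(cylinderE qy) => xy; rewrite -{}xy in q qy *.
exact: mu_inv.2.
Qed.

(** As functions of [A], both sides are finite measures. They agree on the cylinders of length at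
    least [n], which generate the Borel sets and are closed under intersection up to the empty set,
    so they are equal. *)
Lemma invariant_splice n (x y : bpath B) (A : set (borel_path B)) :
  path_vertex x n = path_vertex y n -> measurable A ->
  mu (pcyl n x `&` splice n y @^-1` A) = mu (pcyl n y `&` A).
Proof.
move=> xy mA; have mx := measurable_pcyl n x; have my := measurable_pcyl n y.
have ms := measurable_splice n y.
pose m1 : {measure set (borel_path B) -> \bar R} :=
  pushforward (mrestr mu mx) (splice n y : borel_path B -> borel_path B).
suff : m1 ms A = mrestr mu my A.
  by rewrite /m1 /= /pushforward /mrestr setIC [in RHS]setIC.
apply: (measure_unique (@pcyls B n) (fun=> setT)) => //.
- exact: measurable_pcyls.
- exact: setI_closed_pcyls.
- by move=> _; right; left.
- by apply/seteqP; split=> // z _; exists 0%N.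
- move=> _ [->|[->|[m lenm [z ->]]]]; first by rewrite !measure0.
    rewrite /m1 /= /pushforward /mrestr preimage_setT !setTI.
    exact: invariant_pcyl.
  rewrite /m1 /= /pushforward /mrestr.
  (* The cylinder of [z] either lies in that of [y], and the exchange turns it into a cylinder with
     the same end vertex, or it misses that of [y], and both sides are empty. *)
  have [yz|nyz] := pselect (pcyl n y z).
    have xz : path_vertex x n = path_vertex z n by rewrite xy -(pcyl_vertex yz).
    have -> : splice n y @^-1` pcyl m z `&` pcyl n x = pcyl m (splice n x z).
      apply/seteqP; split=> [t [zt xt] i ltim|t zt].
        have yt : path_vertex y n =
          path_vertex t n by rewrite -xy (pcyl_vertex xt).
        have [ltin|leni] := ltnP i n; first by rewrite (splice_lt xz)// xt.
        by rewrite splice_ge// -(zt i ltim) splice_ge.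
      have xt : pcyl n x t.
        by move=> i ltin; rewrite zt ?(splice_lt xz)// (leq_trans ltin).
      have yt : path_vertex y n =
        path_vertex t n by rewrite -xy (pcyl_vertex xt).
      split=> // i ltim; have [ltin|leni] := ltnP i n.
        by rewrite (splice_lt yt)// yz.
      by rewrite splice_ge// zt// splice_ge.
    have -> : pcyl m z `&` pcyl n y = pcyl m z.
      apply/setIidl => t zt i ltin; rewrite -(yz i ltin); apply: zt.
      exact: leq_trans ltin lenm.
    by apply: invariant_pcyl; rewrite splice_vertex.
  suff [-> ->] : splice n y @^-1` pcyl m z `&` pcyl n x = set0 /\
      pcyl m z `&` pcyl n y = set0 by [].
  split; apply/seteqP; split=> // t [zt xt]; apply: nyz => i ltin.
    have yt : path_vertex y n = path_vertex t n by rewrite -xy (pcyl_vertex xt).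
    by rewrite -(zt i (leq_trans ltin lenm)) (splice_lt yt).
  by rewrite -(zt i (leq_trans ltin lenm)) xt.
- move=> _; rewrite /m1 /= /pushforward /mrestr; rewrite preimage_setT setTI.
  by rewrite ltey_eq fin_num_measure.
Qed.

End Exchange.


(** * The path space of the subdiagram inside that of [B], and its saturation *)

Section Saturation.
Variables (B : bratteli) (W : subdiagram B).
Local Notation Y := (sub_bratteli W).
Local Notation incl := (@sub_path_incl B W).
Implicit Types (x z : bpath B) (y t : bpath Y) (n m : nat).

Lemma incl_vertex_inj n y t :
  path_vertex (incl y) n = path_vertex (incl t) n -> path_vertex y n =
    path_vertex t n.
Proof. by move=> yt; exact: val_inj. Qed.

Lemma incl_vertex n y : path_vertex (incl y) n \in W n.
Proof. exact: (valP (path_vertex y n)). Qed.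

Lemma pcyl_incl n y t : pcyl n (incl y) (incl t) <-> pcyl n y t.
Proof.
split=> yt i /yt ti; first exact: val_inj.
exact: (congr1 val ti).
Qed.

Lemma incl_splice n y t : path_vertex y n = path_vertex t n ->
  incl (splice n y t) = splice n (incl y) (incl t).
Proof.
move=> yt; apply: bpath_ext => i; rewrite /=.
have iyt : path_vertex (incl y) n = path_vertex (incl t) n := congr1 val yt.
have [ltin|leni] := ltnP i n; first by rewrite !splice_lt.
by rewrite !splice_ge.
Qed.

Lemma measurable_incl :
  measurable_fun setT (incl : borel_path Y -> borel_path B).
Proof. by apply: measurable_fun_local => y n; exists n => t;
  rewrite pcyl_incl. Qed.

(** The traces of Borel sets of [B] form a sigma-algebra, and it contains the cylinders of the
    subdiagram. *)
Lemma measurable_incl_preimage (A : set (borel_path Y)) : measurable A ->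
  exists2 A' : set (borel_path B), measurable A' & A = incl @^-1` A'.
Proof.
rewrite (measurable_pcyls Y 0).
have sG : sigma_algebra setT [set A : set (borel_path Y) |
    exists2 A' : set (borel_path B), measurable A' & A = incl @^-1` A'].
  split.
  - by exists set0.
  - move=> _ [A' mA' ->]; exists (~` A'); first exact: measurableC.
    by rewrite setTD.
  - move=> F FA; pose F' n := projT1 (cid2 (FA n)).
    exists (\bigcup_n F' n).
      by apply: bigcup_measurable => n _; rewrite /F'; case: cid2.
    by rewrite preimage_bigcup; apply: eq_bigcupr => n _; rewrite /F'; case:
      cid2.
move: A; apply: smallest_sub sG _ => _ [->|[->|[n _ [y ->]]]].
- by exists set0; [exact: measurable0|rewrite preimage_set0].
- by exists setT; [exact: measurableT|rewrite preimage_setT].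
- exists (pcyl n (incl y)); first exact: measurable_pcyl.
  by apply/seteqP; split=> t; rewrite /= pcyl_incl.
Qed.

(** Conditions on vertices suffice, because the subdiagram has all edges of [B] between its
    vertices. *)
Definition Xge n : set (bpath B) :=
  [set x | forall m, (n <= m)%N -> path_vertex x m \in W m].

Lemma Xge_incl n y : Xge n (incl y).
Proof. by move=> m _; exact: incl_vertex. Qed.

Lemma Xge0E : Xge 0 = range incl.
Proof.
apply/seteqP; split=> [x x0|_ [y _ <-]]; last exact: Xge_incl.
have xW n : (src (x n) \in W n) && (rng (x n) \in W n.+1).
  by rewrite path_compat !x0.
pose y n : edge Y n := exist _ (x n) (xW n).
have yc n : rng (y n) = src (y n.+1) by apply: val_inj; exact: path_compat.
by exists (BPath yc) => //; exact: bpath_ext.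
Qed.

Lemma Xge_nondecreasing n m : (n <= m)%N -> Xge n `<=` Xge m.
Proof. by move=> lenm x xn i /(leq_trans lenm)/xn. Qed.

Lemma measurable_Xge n : measurable (Xge n : set (borel_path B)).
Proof.
have -> : Xge n = \bigcap_(m in [set m | (n <= m)%N])
    [set x | path_vertex x m \in W m].
  by apply/seteqP; split=> x xn m; exact: xn.
apply: bigcap_measurableType => m _.
exact: (measurable_vertex (fun v => v \in W m)).
Qed.

Lemma sub_vertex_path n (v : vert B n) : v \in W n ->
  exists y, path_vertex (incl y) n = v.
Proof.
move=> vW; have [y yv] := vertex_path (exist _ v vW : vert Y n).
by exists y; exact: (congr1 val yv).
Qed.

Lemma Xge_splice n x z : path_vertex x n = path_vertex z n ->
  Xge n z -> Xge n (splice n x z).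
Proof. by move=> xz zn m lenm; rewrite splice_vertex// zn. Qed.

(** After the exchange all vertices lie in [W], those before level [n] because they come from
    [y]. *)
Lemma Xge_tail n x y : Xge n x -> path_vertex (incl y) n = path_vertex x n ->
  exists t, incl t = splice n (incl y) x.
Proof.
move=> xn yx; have : Xge 0 (splice n (incl y) x).
  move=> m _; have [ltmn|lenm] := ltnP m n; last exact: Xge_splice.
  by rewrite /path_vertex splice_lt//; exact: incl_vertex.
by rewrite Xge0E => -[t _ yt]; exists t.
Qed.

Lemma saturationE : saturation W = \bigcup_n Xge n.
Proof.
apply/seteqP; split=> [x [y [n xy]]|x [n _ xn]].
  by exists n => // m /xy; rewrite /path_vertex => ->; exact: incl_vertex.
have [y yx] := sub_vertex_path (xn n (leqnn n)).
have [t tx] := Xge_tail xn yx.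
by exists t, n => m lenm; rewrite tx splice_ge.
Qed.

Lemma measurable_saturation : measurable (saturation W : set (borel_path B)).
Proof.
by rewrite saturationE; apply: bigcup_measurable => n _; exact: measurable_Xge.
Qed.

Lemma Xge_agree n m x z : (n <= m)%N -> pcyl m x z -> Xge m z -> Xge n x ->
  Xge n z.
Proof.
move=> lenm xz zm xn i leni; have [ltim|/zm//] := ltnP i m.
rewrite (@pcyl_vertex _ i x z) ?xn// => j ltji.
by apply: xz; exact: ltn_trans ltji ltim.
Qed.

End Saturation.


(** * Construction of the extension *)

Section Construction.
Variables (B : bratteli) (W : subdiagram B) (R : realType).
Local Notation Y := (sub_bratteli W).
Local Notation incl := (@sub_path_incl B W).
Local Notation Xge := (Xge W).
Implicit Types (x z : bpath B) (y t : bpath Y) (n m : nat).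

(** On the paths that begin like [x] and stay in [W] from level [n] on, [la] is the image of [mu]
    under replacing the prefix of [y] by that of [x]. The construction is used only through this
    property and the null complement of the saturation. *)
Definition transports (mu : set (borel_path Y) -> \bar R)
    (la : set (borel_path B) -> \bar R) : Prop :=
  forall n x y (A : set (borel_path B)), measurable A ->
    path_vertex x n = path_vertex (incl y) n ->
    la (A `&` (Xge n `&` pcyl n x)) =
    mu (pcyl n y `&` [set t | A (splice n x (incl t))]).

(** The paths that enter [W] for good at level [n]. Removing a union treats level 0, where nothing
    is removed, like the other levels. *)
Definition entry n : set (bpath B) := Xge n `\` \bigcup_(m in `I_n) Xge m.

Lemma measurable_entry n : measurable (entry n : set (borel_path B)).
Proof.
apply: measurableD; first exact: measurable_Xge.
by apply: bigcup_measurable => m _; exact: measurable_Xge.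
Qed.

Lemma measurable_splice_incl n x :
  measurable_fun setT (fun t : borel_path Y => splice n x (incl t) :
    borel_path B).
Proof.
apply: (@measurableT_comp _ _ _ (borel_path Y) (borel_path B) (borel_path B)).
  exact: measurable_splice.
exact: measurable_incl.
Qed.

Lemma measurable_splice_incl_set n x (A : set (borel_path B)) : measurable A ->
  measurable ([set t | A (splice n x (incl t))] : set (borel_path Y)).
Proof.
move=> mA; have := @measurable_splice_incl n x measurableT A mA.
by rewrite setTI.
Qed.

Variable mu : {finite_measure set (borel_path Y) -> \bar R}.
Hypothesis mu_inv : invariant_measure mu.

(** The summand belonging to [p]: the image of [mu] under prefix exchange, cut down to [entry n].
    Writing it requires a path [x] with prefix [p] and a path [y] of the subdiagram through the end
    of [p]; if that end is outside [W], there is no such [y] and the summand is zero. *)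
Lemma prefix_measure n (p : fprefix B n) :
  exists ka : {measure set (borel_path B) -> \bar R},
    (tag p \notin W n -> forall A, ka A = 0) /\
    (tag p \in W n -> exists2 xy : bpath B * bpath Y,
       cylinder (tagged p) xy.1 /\ path_vertex (incl xy.2) n = tag p &
       forall A, ka A = mu (pcyl n xy.2 `&`
                        [set t | (A `&` entry n) (splice n xy.1 (incl t))])).
Proof.
have [pW|pW] := boolP (tag p \in W n); last by exists mzero.
have [x px] := cylinder_nonempty (tagged p).
have [y yp] := sub_vertex_path pW.
have ms := @measurable_splice_incl n x.
pose ka : {measure set (borel_path B) -> \bar R} :=
  mrestr (pushforward (mrestr mu (measurable_pcyl n y)) 
    (fun t : borel_path Y => splice n x (incl t) : borel_path B))
    (measurable_entry n).
exists (ka ms); split=> // _; exists (x, y) => // A.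
by rewrite /ka /= /mrestr /pushforward setIC.
Qed.

Definition kappa n (p : fprefix B n) := projT1 (cid (prefix_measure p)).

(* [pickle_inv] rather than [unpickle], so that each prefix counts once. *)
Definition kappas (k : nat) : {measure set (borel_path B) -> \bar R} :=
  if pickle_inv k is Some q
  then kappa (tagged (q : {n : nat & fprefix B n})) else mzero.

Definition extension : {measure set (borel_path B) -> \bar R} :=
  mseries kappas 0.

Lemma extension_saturationC : extension (~` saturation W) = 0.
Proof.
rewrite /extension /= /mseries; apply: eseries0 => k _ _.
rewrite /kappas; case: pickle_inv => // -[n p] /=; rewrite /kappa; case:
  cid => /= ka [ka0 kaW].
have [/kaW[xy _ ->]|/ka0 -> //] := boolP (tag p \in W n).
rewrite [X in mu X](_ : _ = set0) ?measure0//.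
apply/seteqP; split=> // t [_ [nsat [tn _]]]; apply: nsat.
by rewrite saturationE; exists n.
Qed.

(** The summands are expressed at the entry level with their own reference paths, the claim at level
    [n] with [y]. Invariance of [mu] reconciles the two. *)
Lemma extension_transports : transports mu extension.
Proof.
move=> n x y A mA xy; set A' := A `&` _.
have mA' : measurable (A' : set (borel_path B)).
  apply: measurableI => //; apply: measurableI; first exact: measurable_Xge.
  exact: measurable_pcyl.
have [A'0|/set0P[a A'a]] := eqVneq A' set0.
  rewrite A'0 measure0; apply/esym; rewrite [X in mu X](_ : _ =
    set0) ?measure0//.
  apply/seteqP; split=> // t [yt At].
  suff : A' (splice n x (incl t)) by rewrite A'0.
  have xt : path_vertex x n = path_vertex (incl t) n.
    by rewrite xy; apply/esym/pcyl_vertex; rewrite pcyl_incl.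
  split=> //; split; last exact: splice_pcyl.
  by apply: Xge_splice => //; exact: Xge_incl.
have an : Xge n a by case: A'a => _ [].
have xa : pcyl n x a by case: A'a => _ [].
(* [n0] is the level at which [a] enters [W] for good. All paths of [A'] share it, since they have
   the same first [n] edges and stay in [W] from level [n] on. *)
have [n0 [an0 n0min]] : exists n0, Xge n0 a /\ forall m, Xge m a -> (n0 <= m)%N.
  have ex : exists m, `[< Xge m a >] by exists n; exact/asboolP.
  have [n0 /asboolP an0 n0min] := ex_minnP ex.
  by exists n0; split=> // m am; apply: n0min; exact/asboolP.
have len0n : (n0 <= n)%N := n0min _ an.
have entryA' z : A' z -> entry n0 z.
  move=> [_ [zn xz]]; have az : pcyl n a z by rewrite (pcyl_eq xa).
  split; first exact: Xge_agree az zn an0.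
  move=> [m /= ltmn0 zm]; have := ltmn0; rewrite ltnNge n0min//.
  apply: (@Xge_agree _ _ m n z) => //; first exact:
    leq_trans (ltnW ltmn0) len0n.
  by rewrite (pcyl_eq az).
(* All paths in [A'] enter [W] at level [n0] with the same prefix [p0], so that
   a single term of the series defining [extension] survives. *)
pose p0 := prefix_of n0 a.
have kappa0 m (p : fprefix B m) :
    Tagged (fprefix B) p != Tagged (fprefix B) p0 -> kappa p A' = 0.
  move=> pp0; rewrite /kappa; case: cid => /= ka [ka0 kaW].
  have [pW|/ka0 -> //] := boolP (tag p \in W m).
  have [[x1 y1] /= [px1 y1p] ->] := kaW pW.
  rewrite [X in mu X](_ : _ = set0) ?measure0//.
  apply/seteqP; split=> // t [y1t [A't [tm tNm]]].
  have [tn0 tNn0] := entryA' _ A't.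
  have mn0 : m = n0.
    apply/eqP; rewrite eqn_leq; apply/andP; split; rewrite leqNgt; apply/negP.
      by move=> lt; apply: tNm; exists n0.
    by move=> lt; apply: tNn0; exists m.
  subst m; move/eqP: pp0; apply; congr (Tagged _ _).
  have x1t : path_vertex x1 n0 = path_vertex (incl t) n0.
    rewrite (cylinder_vertex px1) -y1p; apply/esym/pcyl_vertex.
    by rewrite pcyl_incl.
  have <- : prefix_of n0 (splice n0 x1 (incl t)) = p.
    by apply/prefix_ofE; rewrite (cylinderE px1); exact: splice_pcyl.
  apply/prefix_of_eq => i lti; case: A't => _ [_ xt].
  by rewrite xt ?xa// (leq_trans lti).
transitivity (kappa p0 A').
  rewrite /extension /= /mseries.
  pose q0 : {n : nat & fprefix B n} := Tagged (fprefix B) p0.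
  have := @nneseriesD1 _ (fun k => kappas k A') (pickle q0) xpredT.
  move=> -> //; rewrite {1}/kappas pickleK_inv /= eseries0 ?adde0// => k _ /=.
  have := pickle_invK (T := {n : nat & fprefix B n}) k.
  rewrite /kappas; case: pickle_inv => [[m p]|//] /= <- /negP pp0.
  by apply: kappa0; apply/eqP => pp0'; apply: pp0; apply/eqP; exact:
    (congr1 pickle pp0').
have p0W : tag p0 \in W n0 by rewrite prefix_of_vertex an0.
rewrite /kappa; case: cid => /= ka [_ /(_ p0W)[[x0 y0] /= [p0x0 y0p0] ->]].
have y0a : path_vertex (incl y0) n0 = path_vertex a n0.
  by rewrite y0p0 prefix_of_vertex.
(* [y1] follows [y0] up to level [n0] and [a] afterwards. On its cylinder of length [n], putting in
   [n0] edges of [x0] has the same effect as putting in [n] edges of [x]. *)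
have [y1 y1E] := Xge_tail an0 y0a.
have y1n : path_vertex (incl y1) n = path_vertex (incl y) n.
  by rewrite y1E splice_vertex// -xy (pcyl_vertex xa).
have x0a : pcyl n0 x0 a.
  by move: (prefix_ofP n0 a); rewrite (cylinderE p0x0).
have y01 : pcyl n0 y0 y1.
  by rewrite -pcyl_incl y1E; exact: splice_pcyl.
have spliceE t : pcyl n y1 t -> splice n0 x0 (incl t) = splice n x (incl t).
  move=> y1t; apply: bpath_ext => i.
  have xt : path_vertex x n = path_vertex (incl t) n.
    by rewrite xy -y1n; apply/esym/pcyl_vertex; rewrite pcyl_incl.
  have y0t : pcyl n0 y0 t.
    by rewrite -(pcyl_eq y01) => j ltj; rewrite y1t// (leq_trans ltj).
  have x0t : path_vertex x0 n0 = path_vertex (incl t) n0.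
    by rewrite -(pcyl_vertex x0a) -y0a; apply/esym/pcyl_vertex;
      rewrite pcyl_incl.
  have [ltin|leni] := ltnP i n; last first.
    by rewrite !splice_ge// (leq_trans len0n).
  rewrite (splice_lt xt)// -(xa i ltin).
  have [ltin0|len0i] := ltnP i n0; first by rewrite (splice_lt x0t)// x0a.
  rewrite splice_ge//; have /pcyl_incl y1t' := y1t.
  by rewrite (y1t' i ltin) y1E splice_ge.
have y1y : path_vertex y1 n = path_vertex y n by exact: incl_vertex_inj.
have mAx := measurable_splice_incl_set n x mA.
(* Moves the right side from the cylinder of [y] to that of [y1], where it becomes the same set as
   on the left. *)
rewrite -(invariant_splice mu_inv y1y mAx).
congr (mu _); apply/seteqP; split=> t [y0t].
  move=> [A't _]; have x0t : path_vertex x0 n0 = path_vertex (incl t) n0.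
    by rewrite -(pcyl_vertex x0a) -y0a; apply/esym/pcyl_vertex;
      rewrite pcyl_incl.
  have y1t : pcyl n y1 t.
    apply/pcyl_incl => i ltin; rewrite y1E.
    have [ltin0|len0i] := ltnP i n0.
      by rewrite splice_lt//; have /pcyl_incl := y0t; apply.
    rewrite [RHS]splice_ge// -(splice_ge x0 (incl t) len0i).
    by case: A't => _ [_ xt]; rewrite xt// xa.
  have yt : path_vertex y n = path_vertex t n by rewrite -y1y (pcyl_vertex y1t).
  split=> //=; rewrite incl_splice// splice_splice//; last exact:
    (congr1 val yt).
    by rewrite -spliceE//; case: A't.
  by rewrite xy; exact: (congr1 val yt).
move=> /=; have yt : path_vertex y n =
  path_vertex t n by rewrite -y1y (pcyl_vertex y0t).
have xt : path_vertex x n = path_vertex (incl t) n.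
  by rewrite xy; exact: (congr1 val yt).
rewrite incl_splice// splice_splice//; last exact: (congr1 val yt).
move=> At; split.
  by rewrite -(pcyl_eq y01) => j ltj; rewrite y0t// (leq_trans ltj).
suff A't : A' (splice n0 x0 (incl t)) by split=> //; exact: entryA'.
rewrite spliceE//; split=> //; split; last exact: splice_pcyl.
by apply: Xge_splice => //; exact: Xge_incl.
Qed.

End Construction.


(** * Transporting measures: restriction, tail invariance and non-atomicity *)

Section Transports.
Variables (B : bratteli) (W : subdiagram B) (R : realType).
Local Notation Y := (sub_bratteli W).
Local Notation incl := (@sub_path_incl B W).
Local Notation Xge := (Xge W).
Implicit Types (x z : bpath B) (y t : bpath Y) (n m : nat).
Variables (mu : {measure set (borel_path Y) -> \bar R})
          (la : {measure set (borel_path B) -> \bar R}).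
Hypothesis la_mu : transports mu la.
Hypothesis la_null : la (~` saturation W) = 0.

(** The case [n = 0] of [transports]: the exchanged prefix is empty and [Xge 0] is the image of
    [incl]. *)
Lemma transports_restriction (A : set (borel_path Y)) :
  measurable A -> la [set incl y | y in A] = mu A.
Proof.
move=> /measurable_incl_preimage[A' mA' ->].
pose y := default_path Y.
have := la_mu mA' (erefl : path_vertex (incl y) 0 = path_vertex (incl y) 0).
rewrite [pcyl 0 (incl y)](_ : _ = setT); last by apply/seteqP; split.
rewrite [pcyl 0 y](_ : _ = setT); last by apply/seteqP; split.
rewrite setIT setTI [X in mu X](_ : _ = incl @^-1` A'); last first.
  have splice0 t : splice 0 (incl y) (incl t) = incl t.
    by apply: bpath_ext => i; rewrite splice_ge.
  by apply/seteqP; split=> t /=; rewrite splice0.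
move=> <-; congr (la _); rewrite Xge0E.
apply/seteqP; split=> [_ [t At <-]|x [Ax [t _ tx]]]; first by split=> //;
  exists t.
by exists t => //; rewrite /= tx.
Qed.

Lemma measure_setI_saturation (A : set (borel_path B)) : measurable A ->
  la A = la (A `&` saturation W).
Proof.
move=> mA; have mS := measurable_saturation W.
rewrite (measureDI la mA mS) [X in X + _](_ : _ = 0) ?add0e//.
apply: (@subset_measure0 _ _ _ la _ (~` saturation W)) => //.
- exact: measurableD.
- exact: measurableC.
Qed.

(** Both masses equal the [mu]-mass of one set of paths of the subdiagram, over a reference path [y]
    through the common vertex. *)
Lemma transports_swap n (a b : bpath B) (C : set (borel_path B)) :
  measurable C -> C `<=` Xge n `&` pcyl n a ->
  path_vertex a n \in W n -> path_vertex a n = path_vertex b n ->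
  let C' := pcyl n b `&` [set z | C (splice n a z)] in
  measurable (C' : set (borel_path B)) /\ la C = la C'.
Proof.
move=> mC Ca aW ab C'.
have mC' : measurable (C' : set (borel_path B)).
  apply: measurableI; first exact: measurable_pcyl.
  by rewrite -[X in measurable X]setTI; exact: measurable_splice.
split=> //; have [y ya] := sub_vertex_path aW.
rewrite -(setIidl Ca).
rewrite (la_mu mC (esym ya : path_vertex a n = path_vertex (incl y) n)).
have C'b : C' `<=` Xge n `&` pcyl n b.
  move=> z [bz Cz]; split=> // m lenm.
  by rewrite -(splice_vertex a z lenm); case: (Ca _ Cz) => + _; apply.
have yb : path_vertex b n = path_vertex (incl y) n by rewrite -ab.
rewrite -(setIidl C'b) (la_mu mC' yb).
congr (mu _); apply/seteqP; split=> t [yt].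
- have yti : path_vertex (incl y) n = path_vertex (incl t) n.
    by apply/esym/pcyl_vertex; rewrite pcyl_incl.
  move=> /= Ct; split=> //; split; first by apply: splice_pcyl; rewrite -ab -ya.
  by rewrite /= splice_splice// -?ab -?ya.
- have yti : path_vertex (incl y) n = path_vertex (incl t) n.
    by apply/esym/pcyl_vertex; rewrite pcyl_incl.
  by move=> /= [_ /=]; rewrite splice_splice// -?ab -?ya.
Qed.

(** Split according to the finitely many values of the common edge. *)
Lemma measurable_agree n (A : set (borel_path B)) (f : borel_path B ->
  borel_path B) :
  measurable A -> measurable_fun A f ->
  measurable (A `&` [set x | (x : bpath B) n = (f x : bpath B) n]).
Proof.
move=> mA mf.
have -> : A `&` [set x | (x : bpath B) n = (f x : bpath B) n] =
    \bigcup_e ([set x : bpath B | x n = e] `&` (A `&` f @^-1` [set x :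
      bpath B | x n = e])).
  apply/seteqP; split=> [x [Ax /= xf]|x [e _ [/= xe [Ax /= fe]]]].
    by exists (x n) => //; split=> //=; split.
  by split=> //=; rewrite xe fe.
have me (e : edge B n) : measurable ([set x | x n = e] : set (borel_path B)).
  by apply: (@measurable_local _ n.+1) => x z /= <- /pcylS[].
apply: fin_bigcup_measurable => [|e _]; first exact: finite_finset.
by apply: measurableI; [exact: me|exact: (mf mA _ (me e))].
Qed.

Section TailBijection.
Variables (A A' : set (borel_path B)) (f : borel_path B -> borel_path B).
Hypotheses (mA : measurable A) (mf : measurable_fun A f) (fA : set_bij A A' f).

(** Here [f] changes at most the first [n] edges, so that it is a prefix exchange once the prefixes
    of [x] and [f x] are fixed. *)
Definition agree_from n : set (borel_path B) :=
  A `&` Xge n `&` [set x | forall m, (n <= m)%N -> (f x : bpath B) m = (x :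
    bpath B) m].

Lemma agree_from_sub n : agree_from n `<=` A. Proof. by move=> x [[]]. Qed.

Lemma measurable_agree_from n : measurable (agree_from n).
Proof.
have -> : agree_from n = (A `&` Xge n) `&`
    \bigcap_(m in [set m | (n <= m)%N])
      (A `&` [set x | (x : bpath B) m = (f x : bpath B) m]).
  apply/seteqP; split=> x.
    by move=> [[Ax xn] xf]; split=> // m /= lenm; split=> //=; rewrite xf.
  by move=> [[Ax xn] xf]; split=> // m /= /xf[].
apply: measurableI; first by apply: measurableI => //; exact: measurable_Xge.
by apply: bigcap_measurableType => m _; exact: measurable_agree.
Qed.

(** Partition by the pair of prefixes of [x] and [f x] and apply [transports_swap] to each piece.
    This also gives measurability of the image, which measurability of [f] alone does not state. *)
Lemma agree_from_image n :
  measurable [set f x | x in agree_from n] /\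
  la (agree_from n) = la [set f x | x in agree_from n].
Proof.
pose F (pq : fprefix B n * fprefix B n) : set (borel_path B) :=
  agree_from n `&` cylinder (tagged pq.1) `&`
  (A `&` f @^-1` (cylinder (tagged pq.2))).
have finj : {in A &, injective f} := set_bij_inj fA.
have mF pq : measurable (F pq).
  apply: measurableI; last by apply: mf => //; exact: measurable_cylinder.
  by apply: measurableI; [exact: measurable_agree_from|exact:
    measurable_cylinder].
have FA pq : F pq `<=` A by move=> x [_ []].
have EF : agree_from n = \bigcup_pq F pq.
  apply/seteqP; split=> [x xE|x [pq _ [[]]]//].
  exists (prefix_of n x, prefix_of n (f x)) => //; split; split=> //=.
  - exact: prefix_ofP.
  - exact: agree_from_sub xE.
  - exact: prefix_ofP.
have tF : trivIset setT F.
  move=> [p q] [p' q'] _ _ [x [[[_ /= px] [_ /= qx]] [[_ /= px'] [_ /= qx']]]].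
  move/prefix_ofE: px px' => <- /prefix_ofE <-.
  by move/prefix_ofE: qx qx' => <- /prefix_ofE <-.
have tfF : trivIset setT (fun pq => [set f x | x in F pq]).
  move=> pq pq' _ _ [_ [[x Fx <-] [x' Fx' xx']]].
  apply: tF => //; exists x; split=> //.
  suff <- : x' = x by [].
  by apply: finj; rewrite ?inE//; [exact: FA Fx'|exact: FA Fx].
have step pq : measurable [set f x | x in F pq] /\
    la (F pq) = la [set f x | x in F pq].
  have [F0|/set0P[a Fa]] := eqVneq (F pq) set0.
    by rewrite F0 image_set0; split=> //; exact: measurable0.
  have [[[[Aa an] fa] pa] [_ qfa]] := Fa.
  have Ca : F pq `<=` Xge n `&` pcyl n a.
    by move=> x [[[[_ xn] _] px] _]; split=> //; rewrite -(cylinderE pa).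
  have afa : path_vertex a n = path_vertex (f a) n.
    by rewrite /path_vertex fa.
  have [] := transports_swap (mF pq) Ca (an n (leqnn n)) afa.
  (* On this piece [f] replaces the prefix of [a] by that of [f a], so the image is the swapped
     set. *)
  suff -> : [set f x | x in F pq] =
      pcyl n (f a) `&` [set z | F pq (splice n a z)] by [].
  apply/seteqP; split=> [_ [x Fx <-]|z [faz Fz]].
    have [[[[Ax xn] fx] px] [_ qfx]] := Fx.
    have ax : pcyl n a x by rewrite -(cylinderE pa).
    split; first by rewrite -(cylinderE qfa).
    suff sx : splice n a (f x) = x by rewrite /= sx.
    have afx : path_vertex a n = path_vertex (f x) n.
      by rewrite /path_vertex fx// -/(path_vertex x n) (pcyl_vertex ax).
    apply: bpath_ext => i; have [ltin|leni] := ltnP i n.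
      by rewrite splice_lt// ax.
    by rewrite splice_ge// fx.
  exists (splice n a z) => //; have [[[[_ _] fx] _] [_ qfx]] := Fz.
  apply: bpath_ext => i; have [ltin|leni] := ltnP i n.
    have /(_ i ltin) : pcyl n (f a) (f (splice n a z)).
      by rewrite -(cylinderE qfa).
    by move=> ->; rewrite faz.
  by rewrite fx// splice_ge.
rewrite EF image_bigcup; split.
  apply: fin_bigcup_measurable => [|pq _]; first exact: finite_finset.
  exact: (step pq).1.
rewrite !measure_fintype_bigcup//; last by move=> pq; exact: (step pq).1.
by apply: eq_bigr => pq _; exact: (step pq).2.
Qed.

End TailBijection.

(** Tail equivalence of [x] and [f x] makes the sets [agree_from A f n] exhaust the part of [A] in
    the saturation; continuity from below passes their equal masses to the limit. *)
Lemma transports_tail_invariant : tail_invariant la.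
Proof.
move=> A A' f mA mA' mf fA xfx.
pose E := agree_from A f.
have ndE n m : (n <= m)%N -> E n `<=` E m.
  move=> lenm x [[Ax xn] fx]; split; first by split=> //; exact:
    Xge_nondecreasing xn.
  by move=> i /(leq_trans lenm)/fx.
have UE : \bigcup_n E n = A `&` saturation W.
  rewrite saturationE; apply/seteqP;
    split=> [x [n _ [[Ax xn] _]]|x [Ax [n _ xn]]].
    by split=> //; exists n.
  have [m fx] := xfx _ Ax; exists (maxn n m) => //; split.
    by split=> //; apply: Xge_nondecreasing xn; exact: leq_maxl.
  by move=> i lei; rewrite fx// (leq_trans (leq_maxr _ _) lei).
have fE : [set f x | x in A `&` saturation W] = A' `&` saturation W.
  have [funf _ sf] := fA.
  apply/seteqP; split=> [_ [x [Ax [y [n xy]]] <-]|z [A'z [y [n zy]]]].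
    split; first exact: funf.
    have [m fx] := xfx _ Ax; exists y, (maxn n m) => i.
    by rewrite geq_max => /andP[ni mi]; rewrite -fx ?xy.
  have [x Ax xz] := sf _ A'z; exists x => //; split=> //.
  have [m fx] := xfx _ Ax; exists y, (maxn n m) => i.
  by rewrite geq_max => /andP[ni mi]; rewrite fx ?xz ?zy.
rewrite (measure_setI_saturation mA) (measure_setI_saturation mA') -fE -UE.
have mE n : measurable (E n) by exact: measurable_agree_from.
have mfE n : measurable [set f x | x in E n] by case:
  (agree_from_image mA mf fA n).
rewrite image_bigcup.
have cE : la \o E @ \oo --> la (\bigcup_n E n).
  apply: nondecreasing_cvg_mu => //; first exact: bigcupT_measurable.
  by move=> n m lenm; rewrite subsetEset; exact: ndE.
have cfE : la \o E @ \oo --> la (\bigcup_n [set f x | x in E n]).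
  have -> : la \o E = la \o (fun n => [set f x | x in E n]).
    by apply/funext => n; case: (agree_from_image mA mf fA n).
  apply: nondecreasing_cvg_mu => //; first exact: bigcupT_measurable.
  by move=> n m lenm; rewrite subsetEset; apply: image_subset; exact: ndE.
exact: cvg_unique cE cfE.
Qed.

(** Countably many pieces [Xge n] with a fixed prefix cover the saturation, so they cannot all be
    null in [A]. *)
Lemma transports_charge (A : set (borel_path B)) : measurable A -> 0 < la A ->
  exists n x, path_vertex x n \in W n /\ 0 < la (A `&` (Xge n `&` pcyl n x)).
Proof.
move=> mA; rewrite (measure_setI_saturation mA).
apply: contraPP => nex.
have null n : la (A `&` Xge n) = 0.
  have mAn : measurable (A `&` Xge n : set (borel_path B)).
    by apply: measurableI => //; exact: measurable_Xge.
  rewrite (measure_fintype_setI la mAn (F := fun p : fprefix B n =>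
    cylinder (tagged p))).
  - apply: big1 => p _; have [x px] := cylinder_nonempty (tagged p).
    rewrite (cylinderE px) -setIA.
    have [xW|xW] := boolP (path_vertex x n \in W n); last first.
      rewrite [X in la X](_ : _ = set0) ?measure0//; apply/seteqP; split=> // z.
      move=> [_ [zn /pcyl_vertex xz]]; move: (zn n (leqnn n)).
      by rewrite xz (negbTE xW).
    apply/eqP; rewrite eq_le measure_ge0 andbT leNgt; apply/negP => la0.
    by apply: nex; exists n, x.
  - by move=> p; exact: measurable_cylinder.
  - exact: trivIset_cylinder.
  - by move=> x _; exists (prefix_of n x) => //; exact: prefix_ofP.
have mAn n : measurable (A `&` Xge n : set (borel_path B)).
  by apply: measurableI => //; exact: measurable_Xge.
apply/negP; rewrite -leNgt.
have -> : A `&` saturation W = \bigcup_n (A `&` Xge n).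
  by rewrite saturationE setI_bigcupr.
have := @measure_sigma_subadditive _ _ _ la _ _ mAn (bigcupT_measurable _ mAn)
  (@subset_refl _ _).
by rewrite eseries0.
Qed.

(** A charged piece of [A] corresponds to a set [D] of positive [mu]-mass. Non-atomicity of [mu]
    gives a smaller [C] inside [D], which is carried back to the piece. *)
Lemma transports_nonatomic : (forall A, measurable A -> mu A < +oo) ->
  nonatomic mu -> nonatomic la.
Proof.
move=> mufin nmu A mA la0; have [n [x [xW la1]]] := transports_charge mA la0.
have [y yx] := sub_vertex_path xW.
have mAn (D : set (borel_path B)) : measurable D ->
    measurable (D `&` (Xge n `&` pcyl n x) : set (borel_path B)).
  move=> mD; apply: measurableI => //; apply: measurableI.
    exact: measurable_Xge.
  exact: measurable_pcyl.
set D := pcyl n y `&` [set t | A (splice n x (incl t))].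
have mD : measurable (D : set (borel_path Y)).
  by apply: measurableI; [exact: measurable_pcyl|exact:
    measurable_splice_incl_set].
have laD : la (A `&` (Xge n `&` pcyl n x)) =
  mu D by rewrite (la_mu mA (esym yx)).
have [C [mC CD C0 CltD]] : exists C : set (borel_path Y),
    [/\ measurable C, C `<=` D, 0 < mu C & mu C < mu D].
  by apply: nmu => //; rewrite -laD.
have [C' mC' CC'] := measurable_incl_preimage mC.
(* [C] is carried back through a Borel set [C'] of [B] with trace [C], so that measurability is
   inherited from [splice]. *)
pose A1 : set (borel_path B) := A `&` [set z | C' (splice n (incl y) z)].
have mA1 : measurable A1.
  by apply: measurableI => //; rewrite -[X in measurable X]setTI; exact:
    measurable_splice.
have laC : la (A1 `&` (Xge n `&` pcyl n x)) = mu C.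
  rewrite (la_mu mA1 (esym yx)); congr (mu _); apply/seteqP; split=> t.
    move=> [yt [_ /=]]; rewrite splice_splice.
    - by rewrite splice_id ?pcyl_incl// CC'.
    - by apply/esym/pcyl_vertex; rewrite pcyl_incl.
    - by rewrite -yx; apply/esym/pcyl_vertex; rewrite pcyl_incl.
  move=> Ct; have [yt At] := CD _ Ct; split=> //; split=> //=.
  rewrite splice_splice.
  - by rewrite splice_id ?pcyl_incl//; move: Ct; rewrite CC'.
  - by apply/esym/pcyl_vertex; rewrite pcyl_incl.
  - by rewrite -yx; apply/esym/pcyl_vertex; rewrite pcyl_incl.
exists (A1 `&` (Xge n `&` pcyl n x)); split.
- exact: mAn.
- by move=> z [[]].
- by rewrite laC.
- rewrite laC (lt_le_trans CltD)// -laD; apply: le_measure; rewrite ?inE//.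
  exact: mAn.
Qed.

End Transports.

Lemma extension_exists (R : realType) (B : bratteli) (W : subdiagram B)
    (mu : {finite_measure set (borel_path (sub_bratteli W)) -> \bar R}) :
  invariant_measure mu ->
  exists muhat : {measure set (borel_path B) -> \bar R}, is_extension mu muhat.
Proof.
move=> mu_inv; exists (extension mu).
have tr := extension_transports mu_inv; have null := extension_saturationC mu.
split=> //.
- apply: (transports_nonatomic tr null) => [A mA|]; last by case: mu_inv.
  by rewrite ltey_eq fin_num_measure.
- exact: (transports_tail_invariant tr null).
- by move=> A mA; exact: (transports_restriction tr).
Qed.


(** * Counting finite paths, and the mass gained from one level to the next *)

(** Sorts the finite paths by the source of the last edge. Divided by [height v], the sum becomes a
    sum of entries of [stochastic]. *)
Lemma card_fpath_src (B : bratteli) n (v : vert B n.+1) (S : {set vert B n}) :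
  #|[pred p : fpath v | src (val (tag p)) \in S]| =
  (\sum_(w in S) incidence v w * height w)%N.
Proof.
rewrite -sum1_card.
transitivity (\sum_(e : {e : edge B n | rng e == v} | src (val e) \in S)
                 \sum_(p : fpath (src (val e))) 1)%N.
  rewrite (@sig_big_dep nat 0%N addn _ (fun e : {e : edge B n | rng e == v} =>
    fpath (src (val e)))
    (fun e => src (val e) \in S) (fun _ => xpredT) (fun _ _ => 1%N)).
  by apply: eq_bigl => p; rewrite andbT.
rewrite (partition_big (fun e : {e : edge B n | rng e == v} =>
  src (val e)) (mem S))//=.
apply: eq_bigr => w wS.
transitivity (\sum_(e : {e : edge B n | rng e == v} |
  src (val e) == w) height w)%N.
  apply: eq_big => [e|e /andP[_ /eqP <-]].
    by case: eqP => [->|]; rewrite ?andbF// wS.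
  by rewrite sum1_card.
rewrite sum_nat_const; congr (_ * _)%N.
rewrite -(card_imset _ val_inj) /incidence; apply: eq_card => e.
apply/imsetP/asboolP => [[e' e'w ->]|/andP[ew ev]].
  by apply/andP; split; [exact: e'w|exact: valP e'].
by exists (exist _ e ev).
Qed.

Section Counting.
Variables (B : bratteli) (W : subdiagram B) (R : realType).
Local Notation Xge := (Xge W).
Variable la : {measure set (borel_path B) -> \bar R}.
Hypothesis la_eq : forall n (x z : bpath B), path_vertex x n =
  path_vertex z n ->
  la (Xge n `&` pcyl n x) = la (Xge n `&` pcyl n z).

(** The counterpart in [B] of [tower W v], with the prefix before level [n] left free. *)
Definition Xat n (v : vert B n) : set (borel_path B) :=
  Xge n `&` [set x | path_vertex x n = v].

Lemma measurable_Xat n (v : vert B n) : measurable (Xat v).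
Proof.
apply: measurableI; first exact: measurable_Xge.
exact: (measurable_vertex (fun w => w = v)).
Qed.

Lemma Xat_notin n (v : vert B n) : v \notin W n -> Xat v = set0.
Proof.
move=> vW; apply/seteqP; split=> // x [xn /= xv].
by move: (xn n (leqnn n)); rewrite xv (negbTE vW).
Qed.

(** [A] is made of the cylinder pieces selected by [Q], and by [la_eq] these have equal mass. *)
Lemma measure_fpath n (x : bpath B) (Q : pred (fpath (path_vertex x n)))
    (A : set (borel_path B)) : measurable A -> A `<=` Xat (path_vertex x n) ->
  (forall p, Q p -> A `&` cylinder p = Xge n `&` cylinder p) ->
  (forall p, ~~ Q p -> A `&` cylinder p = set0) ->
  la A = (#|Q|%:R)%:E * la (Xge n `&` pcyl n x).
Proof.
move=> mA AX QA nQA.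
rewrite (measure_fintype_setI la mA (F := fun p : fpath (path_vertex x n) =>
  cylinder p)).
- rewrite (bigID Q) /= [X in _ + X]big1 ?adde0; last first.
    by move=> p /nQA ->; rewrite measure0.
  transitivity (\sum_(p | Q p) 1%:E * la (Xge n `&` pcyl n x)).
    apply: eq_bigr => p /QA ->; rewrite mul1e.
    have [z pz] := cylinder_nonempty p; rewrite (cylinderE pz).
    by apply: la_eq; exact: cylinder_vertex pz.
  rewrite -ge0_sume_distrl// sumEFin; congr (_%:E * _).
  by rewrite -sum1_card natr_sum.
- by move=> p; exact: measurable_cylinder.
- by move=> p q _ _ [z [/cylinder_inj]]; apply.
- move=> z /AX[_ /= zx]; have [p pz] := prefix_exists z n.
  by rewrite zx in p pz; exists p.
Qed.

Lemma measure_Xat n (x : bpath B) :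
  la (Xat (path_vertex x n)) =
  ((height (path_vertex x n))%:R)%:E * la (Xge n `&` pcyl n x).
Proof.
apply: (@measure_fpath n x xpredT) => //; first exact: measurable_Xat.
move=> p _; apply/seteqP; split=> z; first by move=> [[zn zx] pz].
move=> [zn pz]; split=> //; split=> //=; exact: cylinder_vertex pz.
Qed.

Lemma measure_Xge n (A : set (borel_path B)) : measurable A -> A `<=` Xge n ->
  la A = \sum_(v in W n) la (A `&` Xat v).
Proof.
move=> mA AX; rewrite (measure_fintype_setI la mA (F := @Xat n)).
- rewrite (bigID (fun v => v \in W n)) /= [X in _ + X]big1 ?adde0// => v vW.
  by rewrite Xat_notin// setI0 measure0.
- exact: measurable_Xat.
- by move=> v w _ _ [x [[_ <-] [_ <-]]].
- by move=> x Ax; exists (path_vertex x n) => //; split=> //; exact: AX.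
Qed.

Lemma stochastic_ge0 n (v : vert B n.+1) (w : vert B n) :
  (0 <= stochastic R v w)%R.
Proof. by rewrite mulr_ge0// divr_ge0. Qed.

(** A path of [Xge n.+1] is outside [Xge n] exactly when its vertex at level [n] is outside [W].
    Among the [height v] equally heavy prefixes ending at [v], those with source [w] make up the
    fraction [stochastic R v w]. *)
Lemma measure_XgeD n :
  la (Xge n.+1 `\` Xge n) =
  \sum_(v in W n.+1) \sum_(w in (~:
    W n)%SET) (stochastic R v w)%:E * la (Xat v).
Proof.
have mD : measurable (Xge n.+1 `\` Xge n : set (borel_path B)).
  by apply: measurableD; exact: measurable_Xge.
rewrite (@measure_Xge n.+1 _ mD); last by move=> x [].
apply: eq_bigr => v vW; have [x xv] := vertex_path v; subst v.
rewrite (@measure_fpath n.+1 x [pred p | src (val (tag p)) \in (~: W n)%SET]).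
- rewrite measure_Xat card_fpath_src natr_sum -sumEFin ge0_sume_distrl//.
  apply: eq_bigr => w _; rewrite muleA -EFinM; congr (_%:E * _).
  have hx : ((height (path_vertex x n.+1))%:R != 0 :> R)%R.
    by rewrite pnatr_eq0 -lt0n height_gt0.
  by rewrite /stochastic natrM -mulrA divfK.
- by apply: measurableI => //; exact: measurable_Xat.
- exact: subIsetr.
- move=> p /=; rewrite inE => pW.
  apply/seteqP; split=> z [H pz]; first by split=> //; case: H => -[].
  split=> //; have zx := cylinder_vertex pz; split; split=> //.
  move=> /(_ n (leqnn n)); case: pz => zn _.
  by rewrite /path_vertex zn (negbTE pW).
- move=> p /=; rewrite inE negbK => pW.
  apply/seteqP; split=> // z [[[zn zNn] _] pz]; apply: zNn => m.
  rewrite leq_eqVlt => /predU1P[<-|]; last exact: zn.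
  by case: pz => zp _; rewrite /path_vertex zp.
Qed.

Lemma measure_XgeS n : la (Xge n.+1) = la (Xge n) + la (Xge n.+1 `\` Xge n).
Proof.
have mX m := measurable_Xge W m.
rewrite (measureDI la (mX n.+1) (mX n)) addeC; congr (la _ + _).
by apply/setIidr; exact: Xge_nondecreasing.
Qed.

Lemma Xge_cvg : la \o Xge @ \oo --> la (saturation W).
Proof.
rewrite saturationE; apply: nondecreasing_cvg_mu.
- exact: measurable_Xge.
- by apply: bigcupT_measurable; exact: measurable_Xge.
- by move=> n m lenm; rewrite subsetEset; exact: Xge_nondecreasing.
Qed.

Lemma Xge_le_saturation n : la (Xge n) <= la (saturation W).
Proof.
apply: le_measure; rewrite ?inE.
- exact: measurable_Xge.
- exact: measurable_saturation.
- by rewrite saturationE => x xn; exists n.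
Qed.

(** The increments telescope. *)
Lemma sum_XgeD n :
  \sum_(1 <= k < n) la (Xge k.+1 `\` Xge k) <= la (saturation W).
Proof.
case: n => [|n]; first by rewrite big_geq.
apply: le_trans (Xge_le_saturation n.+1); elim: n => [|n IH].
  by rewrite big_geq.
by rewrite big_nat_recr//= measure_XgeS leeD2r.
Qed.

End Counting.

(** * Masses under an arbitrary extension *)

Section Extension.
Variables (B : bratteli) (W : subdiagram B) (R : realType).
Local Notation Y := (sub_bratteli W).
Local Notation incl := (@sub_path_incl B W).
Local Notation Xge := (Xge W).
Variables (mu : {measure set (borel_path Y) -> \bar R})
          (la : {measure set (borel_path B) -> \bar R}).
Hypothesis la_ext : is_extension mu la.

(** The exchange [splice n x] is a bijection from the image of the cylinder of [y] onto the
    left-hand set and changes only finitely many edges, so tail invariance applies. *)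
Lemma extension_pcyl n (x : bpath B) (y : bpath Y) :
  path_vertex x n = path_vertex (incl y) n ->
  la (Xge n `&` pcyl n x) = mu (pcyl n y).
Proof.
move=> xy; rewrite -(extension_restriction la_ext); last exact: measurable_pcyl.
have -> : [set incl t | t in pcyl n y] = Xge 0 `&` pcyl n (incl y).
  apply/seteqP; split=> [_ [t yt <-]|z []].
    by split; [exact: Xge_incl|rewrite pcyl_incl].
  by rewrite Xge0E => -[t _ <-]; rewrite pcyl_incl => yt; exists t.
have vertexE z : pcyl n (incl y) z -> path_vertex x n = path_vertex z n.
  by rewrite xy => /pcyl_vertex.
apply/esym/(extension_invariant la_ext (f := splice n x)).
- by apply: measurableI; [exact: measurable_Xge|exact: measurable_pcyl].
- by apply: measurableI; [exact: measurable_Xge|exact: measurable_pcyl].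
- by apply: (@measurable_funS _ _ (borel_path B) (borel_path B) setT);
  last exact: measurable_splice.
- split.
  + move=> z [z0 yz]; have xz := vertexE _ yz; split; last exact: splice_pcyl.
    by apply: Xge_splice => //; exact: Xge_nondecreasing z0.
  + move=> z z'; rewrite !inE => -[_ yz] [_ yz'] zz'.
    rewrite -(splice_id yz) -(splice_id yz').
    have xz := vertexE _ yz; have xz' := vertexE _ yz'.
    by rewrite -(@splice_splice _ n (incl y) x z) -?xy// zz' splice_splice//
      -xy.
  + move=> z [zn xz]; have yz : path_vertex (incl y) n = path_vertex z n.
      by rewrite -xy (pcyl_vertex xz).
    have [t ty] := Xge_tail zn yz; exists (splice n (incl y) z).
      by rewrite -ty; split; [exact: Xge_incl|rewrite ty; exact: splice_pcyl].
    by rewrite splice_splice ?splice_id// (pcyl_vertex xz).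
- by move=> z _; exists n => i leni; rewrite splice_ge.
Qed.

(** Provides the hypothesis [la_eq] of the counting lemmas. Through a vertex outside [W] both sets
    are empty. *)
Lemma extension_eq n (x z : bpath B) : path_vertex x n = path_vertex z n ->
  la (Xge n `&` pcyl n x) = la (Xge n `&` pcyl n z).
Proof.
move=> xz; have [xW|xW] := boolP (path_vertex x n \in W n).
  have [y yx] := sub_vertex_path xW.
  by rewrite !(@extension_pcyl _ _ y)// -?xz.
have empty (t : bpath B) : path_vertex t n \notin W n -> Xge n `&` pcyl n t =
  set0.
  move=> tW; apply/seteqP; split=> // u [un /pcyl_vertex tu].
  by move: (un n (leqnn n)); rewrite tu (negbTE tW).
by rewrite !empty -?xz.
Qed.

Lemma tower_le n (v : vert B n) : mu (tower W v) <= la (Xat W v).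
Proof.
have mT : measurable (tower W v : set (borel_path Y)).
  by apply: (@measurable_local _ n) => y t /= <- yt; apply/pcyl_vertex;
    rewrite pcyl_incl.
rewrite -(extension_restriction la_ext mT).
have -> : [set incl y | y in tower W v] = Xge 0 `&` Xat W v.
  apply/seteqP; split=> [_ [y yv <-]|x []].
    by split; [exact: Xge_incl|split=> //; exact: Xge_incl].
  by rewrite Xge0E => -[y _ <-] [_ yv]; exists y.
have mX := measurable_Xat W v.
apply: le_measure; rewrite ?inE//.
by apply: measurableI => //; exact: measurable_Xge.
Qed.

(** There are finitely many prefixes of length [n], and each contributes the finite mass of a
    cylinder of the subdiagram. *)
Lemma extension_Xge_lty n : (forall A, measurable A -> mu A < +oo) ->
  la (Xge n) < +oo.
Proof.
move=> mufin; rewrite (measure_Xge la (measurable_Xge W n) (@subset_refl _ _)).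
apply: lte_sum_pinfty => v vW; have [y yv] := sub_vertex_path vW.
rewrite (setIidr (_ : Xat W v `<=` Xge n)); last by move=> x [].
rewrite -yv measure_Xat; last exact: extension_eq.
rewrite (@extension_pcyl _ _ y)//.
by apply: lte_mul_pinfty => //; apply: mufin; exact: measurable_pcyl.
Qed.

End Extension.


(** * Bounded masses from summable relative increments, and the theorem *)

Lemma bounded_of_relative_increments (R : realType) (M e : nat -> R) N :
  (forall n, 0 <= M n)%R -> (forall n, 0 <= e n)%R ->
  (forall n, M n <= M n.+1)%R ->
  (forall n, (N <= n)%N -> M n.+1 <= M n + e n * M n.+1)%R ->
  (forall n, \sum_(N <= k < n) e k <= 2^-1)%R ->
  forall n, (N <= n)%N -> (M n <= 2 * M N)%R.
Proof.
move=> M0 e0 ndM Me sum_e n /subnKC <-; move: (n - N)%N => {}n.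
(* As [M] is nondecreasing, its last value can replace the earlier ones in every increment. With a
   sum of at most one half, the last term is then absorbed on the left. *)
have bound : (M (N + n)%N <= M N + (\sum_(N <= k < N + n) e k) * M (N + n)%N)%R.
  elim: n => [|n IH]; first by rewrite addn0 big_geq// mul0r addr0.
  rewrite addnS big_nat_recr ?leq_addr//= mulrDl addrA.
  apply: le_trans (Me _ (leq_addr _ _)) _; rewrite lerD2r.
  apply: le_trans IH _; rewrite lerD2l ler_wpM2l ?sumr_ge0//.
have := ler_wpM2r (M0 (N + n)%N) (sum_e (N + n)%N).
lra.
Qed.

Lemma extension_finite (R : realType) (B : bratteli) (W : subdiagram B)
    (mu : {measure set (borel_path (sub_bratteli W)) -> \bar R})
    (la : {measure set (borel_path B) -> \bar R}) :
  (forall A, measurable A -> mu A < +oo) -> is_extension mu la ->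
  \sum_(1 <= n <oo) \sum_(v in W n.+1) \sum_(w in (~: W n)%SET)
     (stochastic R v w)%:E < +oo ->
  la (saturation W) < +oo.
Proof.
move=> mufin la_ext.
pose e n : R := (\sum_(v in W n.+1) \sum_(w in (~:
  W n)%SET) stochastic R v w)%R.
have eE n : \sum_(v in W n.+1) \sum_(w in (~:
  W n)%SET) (stochastic R v w)%:E = (e n)%:E.
  by rewrite -sumEFin; apply: eq_bigr => v _; rewrite sumEFin.
have e0 n : (0 <= e n)%R.
  by apply: sumr_ge0 => v _; apply: sumr_ge0 => w _; exact: stochastic_ge0.
under eq_eseriesr do rewrite eE.
rewrite eseries_cond => sume.
have tail : \sum_(N <= k <oo | (0 < k)%N) (e k)%:E @[N --> \oo] --> 0.
  by apply: nneseries_tail_cvg => // k _; rewrite lee_fin.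
(* A tail below one half is what the absorption needs. [N] is positive since the series starts at 1,
   so that [0 < k] holds for all [k] from [N] on. *)
have [N N0 tailN] : exists2 N, (0 < N)%N &
    \sum_(N <= k <oo | (0 < k)%N) (e k)%:E < (2^-1)%:E.
  have half : 0 < (2^-1)%:E :> \bar R by rewrite lte_fin invr_gt0.
  have [m _ tailm] := tail _ (open_ereal_lt' half).
  by exists (maxn m 1); [rewrite leq_maxr|apply: tailm => /=; exact: leq_maxl].
have Xfin n : la (Xge W n) \is a fin_num.
  by rewrite ge0_fin_numE//; exact: extension_Xge_lty la_ext _ mufin.
have la_eq := extension_eq la_ext.
pose M n := fine (la (Xge W n)).
have ME n : (M n)%:E = la (Xge W n) by rewrite /M fineK.
have M0 n : (0 <= M n)%R by rewrite -lee_fin ME.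
have ndM n : (M n <= M n.+1)%R by rewrite -lee_fin !ME measure_XgeS leeDl.
(* Every [la (Xat W v)] in [measure_XgeD] is at most [la (Xge W n.+1)], which leaves the factor
   [e n]. *)
have Me n : (M n.+1 <= M n + e n * M n.+1)%R.
  rewrite -lee_fin EFinD EFinM !ME [leLHS]measure_XgeS leeD2l// measure_XgeD//.
  rewrite -eE ge0_sume_distrl; last first.
    by move=> v _; apply: sume_ge0 => w _; rewrite lee_fin stochastic_ge0.
  apply: lee_sum => v _; rewrite ge0_sume_distrl; last first.
    by move=> w _; rewrite lee_fin stochastic_ge0.
  apply: lee_sum => w _; apply: lee_wpmul2l;
    first by rewrite lee_fin stochastic_ge0.
  apply: le_measure; rewrite ?inE.
  - exact: measurable_Xat.
  - exact: measurable_Xge.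
  - by move=> x [].
have sumN n : (\sum_(N <= k < n) e k <= 2^-1)%R.
  rewrite -lee_fin -sumEFin; apply: le_trans (ltW tailN).
  apply: le_trans (nneseries_lim_ge n _); last by move=> k _ _; rewrite lee_fin.
  rewrite [leRHS]big_mkcond /= big_nat [leRHS]big_nat lee_sum// =>
    k /andP[Nk _].
  by rewrite (leq_trans N0 Nk).
have bound := bounded_of_relative_increments M0 e0 ndM (fun n _ => Me n) sumN.
apply: (@le_lt_trans _ _ (2 * M N)%:E); last by rewrite ltry.
have XN := @Xge_cvg _ W _ la.
rewrite -(cvg_lim _ XN)//; apply: lime_le; first by apply/cvg_ex; eexists;
  exact: XN.
exists N => // n /= leNn; rewrite -ME lee_fin; exact: bound.
Qed.

Theorem proposition6p1 (R : realType) (B : bratteli) (d : nat)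
    (rankB : finite_rank B d) (W : subdiagram B)
    (properW : forall n : nat, (0 < n)%N ->
       W n != finset.set0 /\ W n \proper [set: vert B n]%SET) :
  (forall mu : {finite_measure set (borel_path (sub_bratteli W)) -> \bar R},
     invariant_measure mu ->
     forall muhat : {measure set (borel_path B) -> \bar R},
       is_extension mu muhat -> muhat (saturation W) < +oo ->
       \sum_(1 <= n <oo) \sum_(v in W n.+1) \sum_(w in (~: W n)%SET)
          (stochastic R v w)%:E * mu (tower W v) < +oo)
  /\
  (\sum_(1 <= n <oo) \sum_(v in W n.+1) \sum_(w in (~: W n)%SET)
      (stochastic R v w)%:E < +oo ->
   forall mu : probability (borel_path (sub_bratteli W)) R,
     invariant_measure mu ->
     exists muhat : {measure set (borel_path B) -> \bar R},
       is_extension mu muhat /\ muhat (saturation W) < +oo).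
Proof.
split=> [mu _ la la_ext la_fin|sumq mu mu_inv].
  apply: le_lt_trans la_fin; apply: lime_le.
    apply: is_cvg_nneseries => n _ _; apply: sume_ge0 => v _.
    by apply: sume_ge0 => w _; rewrite mule_ge0// lee_fin stochastic_ge0.
  (* Partial sums are compared term by term with the increments of [Xge], whose total is at most the
     mass of the saturation. *)
  apply: nearW => n; apply: le_trans (sum_XgeD W la n); apply: lee_sum => k _.
  rewrite measure_XgeD; last exact: extension_eq la_ext.
  apply: lee_sum => v _; apply: lee_sum => w _.
  apply: lee_wpmul2l; first by rewrite lee_fin stochastic_ge0.
  exact: (tower_le la_ext).
have [la la_ext] := @extension_exists R B W mu mu_inv.
exists la; split=> //; apply: extension_finite la_ext sumq => A mA.
by rewrite ltey_eq fin_num_measure.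
Qed.
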